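(* Let $\Gamma$ be a finite regular graph of valency at least $4$, and suppose there is a finite solvable group $G$ acting on $\Gamma$ by automorphisms such that $\Gamma$ is $G$-arc-transitive. Then $\Gamma$ admits a nowhere-zero $3$-flow.
   Context: All graphs are finite and undirected. Given an orientation of a graph $\Gamma$ and an integer $k\ge 2$, a $k$-flow is a function $f:E(\Gamma)\to\{0,\pm1,\dots,\pm(k-1)\}$ such that for every vertex $v$, the sum of $f(e)$ over edges $e$ with tail $v$ equals the sum of $f(e)$ over edges $e$ with head $v$. It is nowhere-zero if $f(e)\neq 0$ for all $e$; the existence of a nowhere-zero $k$-flow does not depend on the chosen orientation. A group $G$ acts on $\Gamma$ by automorphisms if it acts on $V(\Gamma)$ (not necessarily faithfully) preserving adjacency and non-adjacency. $\Gamma$ is $G$-arc-transitive if $G$ is transitive on $V(\Gamma)$ and on the set of arcs (ordered pairs of adjacent vertices) of $\Gamma$. *)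

(* Defs.v *)
From HB Require Import structures.
From mathcomp Require Import all_boot all_order all_algebra all_fingroup all_solvable.
Set Implicit Arguments. Unset Strict Implicit. Unset Printing Implicit Defensive.
Import Order.TTheory GRing.Theory Num.Theory.

Definition simple_graph (V : finType) (adj : rel V) : Prop :=
  symmetric adj /\ irreflexive adj.

Definition regular_of_valency (V : finType) (adj : rel V) (k : nat) : Prop :=
  forall v : V, #|[set w | adj v w]| = k.

Definition acts_by_automorphisms (gT : finGroupType) (G : {group gT}) (V : finType)
  (to : action G V) (adj : rel V) : Prop :=
  forall g, g \in G -> forall x y : V, adj (to x g) (to y g) = adj x y.

Definition arc_transitive (gT : finGroupType) (G : {group gT}) (V : finType)
  (to : action G V) (adj : rel V) : Prop :=
  [transitive G, on [set: V] | to] /\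
  (forall x y x' y' : V, adj x y -> adj x' y' ->
     exists2 g, g \in G & to x g = x' /\ to y g = y').

Definition orientation (V : finType) (adj : rel V) (D : rel V) : Prop :=
  (forall x y, D x y -> adj x y) /\
  (forall x y, adj x y -> (D x y && ~~ D y x) || (D y x && ~~ D x y)).

Definition is_k_flow (V : finType) (D : rel V) (k : nat) (f : V -> V -> int) : Prop :=
  (forall x y, D x y -> (`|f x y| < k%:Z)%R) /\
  (forall v : V, (\sum_(y | D v y) f v y = \sum_(x | D x v) f x v)%R).

Definition nowhere_zero (V : finType) (D : rel V) (f : V -> V -> int) : Prop :=
  forall x y, D x y -> f x y <> 0%R.

(* The graph admits a nowhere-zero k-flow (for some, equivalently every, orientation). *)
Definition has_nz_flow (V : finType) (adj : rel V) (k : nat) : Prop :=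
  exists (D : rel V) (f : V -> V -> int),
    [/\ orientation adj D, is_k_flow D k f & nowhere_zero D f].

(* Main.v *)
Require Import Defs.
From HB Require Import structures.
From mathcomp Require Import all_boot all_order all_algebra all_fingroup all_solvable.
From mathcomp Require Import zify ring.
Set Implicit Arguments. Unset Strict Implicit. Unset Printing Implicit Defensive.
Import Order.TTheory GRing.Theory Num.Theory.

(** If the valency is even, an Eulerian orientation carries a flow with values
    1 and -1. Let it be odd, hence at least 5, and let N be a minimal normal
    subgroup of G (made faithful), an elementary abelian p-group. By
    arc-transitivity either every edge lies inside an N-orbit or none does, and
    in the latter case a vertex has the same number m of neighbours in each
    N-orbit where it has one.
    - All edges inside orbits: p = 2 by the handshake lemma, and each orbit
      carries a Cayley graph of an elementary abelian 2-group. Its connection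
      set contains three independent elements, spanning bipartite cubic graphs
      (cubes); what remains has even valency.
    - m >= 2: each pair of adjacent orbits spans an m-regular bipartite graph,
      which by Hall's theorem splits into three perfect matchings, weighted
      -2, 1, 1, and an even graph (or is itself even).
    - m = 1: the graph covers its quotient by N, a smaller graph satisfying the
      same hypotheses, whose flow lifts. *)

(** * Two-colourings alternating under two involutions *)

Lemma enum_rank_ltN (T : finType) (x y : T) :
  x != y -> (enum_rank x < enum_rank y) = ~~ (enum_rank y < enum_rank x).
Proof.
move=> xy; rewrite -leqNgt ltn_neqAle; case: eqP => //= /val_inj/enum_rank_inj exy.
by rewrite exy eqxx in xy.
Qed.

Section TwoInvolutions.

Variables (D : finType) (A : pred D) (s t : D -> D).
Hypotheses (sK : involutive s) (tK : involutive t).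
Hypotheses (As : forall d, A d -> A (s d)) (At : forall d, A d -> A (t d)).
Hypotheses (s_neq : forall d, A d -> s d != d) (t_neq : forall d, A d -> t d != d).

Let phi d := s (t d).

Let phi_inj : injective phi.
Proof. by apply: inj_comp (inv_inj sK) (inv_inj tK). Qed.

(** In the dihedral group generated by [s] and [t], an equality between the [n]-th iterate at [d]
    and [s d] descends to the same equality at [phi d] with [n - 2] iterations. The descent ends in
    a fixed point of [s] or of [t]. *)
Lemma iter_involutions_neq n d : A d -> iter n phi d != s d.
Proof.
suff: A d -> iter n phi d != s d /\ iter n.+1 phi d != s d by move=> H /H [].
elim: n d => [|n IHn] d Ad.
  split=> /=; first by rewrite eq_sym s_neq.
  by rewrite (inj_eq (inv_inj sK)) t_neq.
have [_ IH1] := IHn d Ad; split=> //.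
have Apd : A (phi d) by exact/As/At.
have [IH0 _] := IHn (phi d) Apd.
apply: contra IH0; rewrite [iter n.+2 _ _]iterS iterSr /phi (inj_eq (inv_inj sK)) sK.
by move/eqP/(congr1 t); rewrite tK => ->.
Qed.

(** The [phi]-cycles of [d] and of [s d] are distinct by the previous lemma, and both [s] and [t]
    exchange them. The colour records which of the two cycle representatives has the smaller rank,
    so it flips under either involution. *)
Lemma involutions_two_colourable :
  exists c : D -> bool, forall d, A d -> c (s d) = ~~ c d /\ c (t d) = ~~ c d.
Proof.
have sym := fconnect_sym phi_inj.
exists (fun d => enum_rank (froot phi d) < enum_rank (froot phi (s d))) => d Ad.
have ne x : A x -> froot phi x != froot phi (s x).
  move=> Ax; rewrite (root_connect sym); apply/negP => cxs.
  by have := iter_involutions_neq (findex phi x (s x)) Ax; rewrite iter_findex // eqxx.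
split; first by rewrite sK enum_rank_ltN // eq_sym ne.
have -> : froot phi (t d) = froot phi (s d).
  apply/eqP; rewrite (root_connect sym) sym; have -> : t d = finv phi (s d); last exact: fconnect_finv.
    by apply: phi_inj; rewrite f_finv // /phi tK.
have -> : froot phi (s (t d)) = froot phi d.
  by apply/eqP; rewrite (root_connect sym) sym; exact: fconnect1.
by rewrite enum_rank_ltN // eq_sym ne.
Qed.

End TwoInvolutions.

(** Serves to pair off the edges at a vertex of even degree, as the passages of an Eulerian circuit
    through that vertex do. *)
Lemma even_set_pairing (T : finType) (A : {set T}) : ~~ odd #|A| ->
  exists h : T -> T, involutive h /\ {in A, forall x, h x \in A /\ h x != x}.
Proof.
elim: {A}_.+1 {-2}A (ltnSn #|A|) => // n IHn A leAn evA.
have [->|[x xA]] := set_0Vmem A; first by exists id; split=> // x; rewrite inE.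
have [Ax0|[y yA]] := set_0Vmem (A :\ x).
  by move: evA; rewrite (cardsD1 x) xA Ax0 cards0.
have eA : #|A| = #|A :\ x :\ y|.+2 by rewrite (cardsD1 x) xA (cardsD1 y) yA.
have [||h [hK hA]] := IHn (A :\ x :\ y).
- by move: leAn; rewrite eA; lia.
- by move: evA; rewrite eA /= negbK.
have xy : y != x by move: yA; rewrite in_setD1 => /andP[].
pose inB z := z \in A :\ x :\ y.
exists (fun z => if inB z then h z else if (z == x) || (z == y) then tperm x y z else z).
have inBx : inB x = false by rewrite /inB !inE eqxx /= andbF.
have inBy : inB y = false by rewrite /inB !inE eqxx.
split=> z.
  have [Bz|Bz] := boolP (inB z).
    by have -> : inB (h z) by exact: (hA _ Bz).1.
  case: eqP => [->|zx]/=; first by rewrite tpermL inBy eqxx orbT tpermR.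
  case: eqP => [->|zy]/=; first by rewrite tpermR inBx eqxx /= tpermL.
  by rewrite (negPf Bz); case: eqP; case: eqP.
move=> zA; case: ifPn => [Bz|nB].
  by have [+ ->] := hA _ Bz; rewrite !inE => /and3P[_ _ ->].
move: nB; rewrite /inB !inE zA andbT negb_and !negbK orbC.
case: eqP => [->|_]/=; first by rewrite tpermL xy; move: yA; rewrite inE => /andP[_ ->].
by case: eqP => [->|//]; rewrite tpermR eq_sym xy xA.
Qed.

(** * Degrees and the handshake lemma *)

Definition deg (T : finType) (e : rel T) (u : T) := #|[set v | e u v]|.

Lemma deg_sum (T : finType) (e : rel T) u : deg e u = \sum_v (e u v : nat).
Proof.
rewrite /deg -sum1_card big_mkcond; apply: eq_bigr => v _.
by rewrite inE; case: (e u v).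
Qed.

Lemma sum_adj_deg (T : finType) (e : rel T) u :
  (\sum_v (e u v)%:R = (deg e u)%:R :> int)%R.
Proof. by rewrite deg_sum natr_sum. Qed.

Lemma deg_gt0 (T : finType) (e : rel T) u v : e u v -> 0 < deg e u.
Proof. by move=> euv; apply/card_gt0P; exists v; rewrite inE. Qed.

Lemma handshake (T : finType) (e : rel T) :
  symmetric e -> irreflexive e -> ~~ odd (\sum_u deg e u).
Proof.
move=> sym irr; pose lt (u v : T) := enum_rank u < enum_rank v.
have -> : \sum_u deg e u = \sum_u \sum_v (e u v && lt u v) + \sum_u \sum_v (e v u && lt v u).
  rewrite -big_split; apply: eq_bigr => u _; rewrite deg_sum -big_split.
  apply: eq_bigr => v _ /=; rewrite (sym v).
  have [->|uv] := eqVneq u v; first by rewrite irr.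
  by rewrite /lt (enum_rank_ltN uv); case: (e u v) => //=; case: (_ < _).
by rewrite [X in _ + X]exchange_big /= addnn odd_double.
Qed.

Lemma deg_diff (T : finType) (e M : rel T) u : subrel M e ->
  deg [rel x y | e x y && ~~ M x y] u = deg e u - deg M u.
Proof.
move=> sMe; rewrite /deg -cardsDS; last by apply/subsetP => v; rewrite !inE; apply: sMe.
by apply: eq_card => v; rewrite !inE andbC.
Qed.

(** * Skew flows, Eulerian flows and edge decompositions *)

(* A nowhere-zero 3-flow presented as an antisymmetric matrix whose support is
   the edge set, so that no orientation has to be fixed. *)
Definition skew_flow (T : finType) (e : rel T) (f : T -> T -> int) : Prop :=
  [/\ forall u v, f v u = (- f u v)%R,
      forall u v, (f u v != 0%R) = e u v,
      forall u v, (`|f u v| <= 2%:Z)%R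
    & forall u, (\sum_v f u v = 0)%R].

Definition has_skew_flow (T : finType) (e : rel T) := exists f, skew_flow e f.

Lemma skew_flow_eq0 (T : finType) (e : rel T) f u v :
  skew_flow e f -> ~~ e u v -> f u v = 0%R.
Proof. by case=> _ ef _ _; rewrite -ef negbK => /eqP. Qed.

Lemma eq_has_skew_flow (T : finType) (e e' : rel T) :
  e =2 e' -> has_skew_flow e -> has_skew_flow e'.
Proof. by move=> ee [f [? ef ? ?]]; exists f; split=> // u v; rewrite -ee. Qed.

(** Each edge is oriented in the direction in which its value is positive. *)
Lemma has_nz_flow_skew (V : finType) (adj : rel V) :
  has_skew_flow adj -> has_nz_flow adj 3.
Proof.
case=> f [fN fe f2 f0].
pose D : rel V := fun x y => (0 < f x y)%R.
have De x y : D x y -> adj x y by rewrite /D -fe; case: ltgtP.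
exists D, f; split.
- by split=> // x y; rewrite -fe /D (fN x y) oppr_gt0; case: ltgtP.
- split=> [x y _|v]; first by have := f2 x y; lia.
  have := f0 v; rewrite (bigID (D v)) /= => /eqP; rewrite addr_eq0 => /eqP ->.
  rewrite -sumrN big_mkcond [RHS]big_mkcond; apply: eq_bigr => x _.
  rewrite /D (fN v x) oppr_gt0; by case: ltgtP => //= <-; rewrite oppr0.
- by move=> x y; rewrite /D; lia.
Qed.

(** Euler's argument on darts [(u, v)]: one involution reverses a dart, the other passes to its
    partner at [u]. A sign that flips under the first is antisymmetric, and one that flips under the
    second cancels at every vertex. *)
Lemma has_skew_flow_even (T : finType) (e : rel T) :
  symmetric e -> irreflexive e -> (forall u, ~~ odd (deg e u)) -> has_skew_flow e.
Proof.
move=> sym irr ev.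
have [mate mateP] := fin_all_exists (fun u => even_set_pairing (ev u)).
have mK u : involutive (mate u) := (mateP u).1.
have mA u v : e u v -> e u (mate u v) /\ mate u v != v.
  by move=> euv; have := (mateP u).2 v; rewrite !inE; apply.
have em u v : e u (mate u v) = e u v.
  by apply/idP/idP => /mA[] //; rewrite mK.
have [||||||c cP] := @involutions_two_colourable _ (fun d : T * T => e d.1 d.2)
  (fun d => (d.2, d.1)) (fun d => (d.1, mate d.1 d.2)).
- by case.
- by case=> u v /=; rewrite mK.
- by case=> u v /=; rewrite sym.
- by case=> u v /= /mA[].
- case=> u v /= euv; rewrite xpair_eqE negb_and; case: eqP euv => //= ->.
  by rewrite irr.
- by case=> u v /= /mA[_]; rewrite xpair_eqE eqxx.
pose f u v : int := (if e u v then (-1) ^+ c (u, v) else 0)%R.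
exists f; split=> [u v|u v|u v|u]; rewrite /f.
- rewrite sym; case: ifP => [euv|_]; last by rewrite oppr0.
  by have [/= -> _] := cP (u, v) euv; case: (c _).
- by case: (e u v); case: (c _).
- by case: (e u v); case: (c _).
(* Reindexing along the pairing at [u] negates every term, so the sum equals its own opposite. *)
- have S : (\sum_v f u v = - \sum_v f u v)%R.
    rewrite {1}(reindex_inj (inv_inj (mK u))) /= -sumrN; apply: eq_bigr => v _.
    rewrite /f em; case: ifP => [euv|_]; last by rewrite oppr0.
    by have [/= _ ->] := cP (u, v) euv; case: (c _).
  by move: S; rewrite /f; lia.
Qed.

(** An edge takes its value from the flow of its own class only, so the bound by 2 survives, while
    conservation adds up over the classes. *)
Lemma has_skew_flow_classes (T I : finType) (e : rel T) (cl : T -> T -> I) :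
  (forall u v, cl u v = cl v u) ->
  (forall i, has_skew_flow [rel u v | e u v && (cl u v == i)]) -> has_skew_flow e.
Proof.
move=> clC /fin_all_exists[f fP].
exists (fun u v => f (cl u v) u v); split=> [u v|u v|u v|u].
- by rewrite clC; case: (fP (cl u v)).
- by case: (fP (cl u v)) => _ -> _ _; rewrite /= eqxx andbT.
- by case: (fP (cl u v)).
- transitivity (\sum_i \sum_v f i u v)%R.
    rewrite exchange_big /=; apply: eq_bigr => v _.
    rewrite (bigD1 (cl u v)) //= big1 ?addr0 // => i ne.
    by apply: (skew_flow_eq0 (fP i)); rewrite /= eq_sym (negPf ne) andbF.
  by rewrite big1 // => i _; case: (fP i).
Qed.

Lemma has_skew_flow_split (T : finType) (e M : rel T) :
  symmetric M -> subrel M e -> has_skew_flow M ->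
  has_skew_flow [rel x y | e x y && ~~ M x y] -> has_skew_flow e.
Proof.
move=> symM sMe fM fe; apply: (@has_skew_flow_classes _ _ _ M) => // -[].
  by apply: eq_has_skew_flow fM => x y /=; case: (boolP (M x y)) => [/sMe ->|]; rewrite ?andbF.
by apply: eq_has_skew_flow fe => x y /=; case: (M x y).
Qed.

(** * Hall's theorem and perfect matchings *)

(** Induction on the size of [A], according to whether some nonempty proper subset is tight, that
    is, has no more neighbours than elements. The point [y0] supplies a value for [h] when [A] is
    empty. *)
Lemma hall_marriage (S T : finType) (A : {set S}) (N : S -> {set T}) (y0 : T) :
  (forall X : {set S}, X \subset A -> #|X| <= #|\bigcup_(x in X) N x|) ->
  exists h : S -> T, {in A, forall x, h x \in N x} /\ {in A &, injective h}.
Proof.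
elim: {A}_.+1 {-2}A (ltnSn #|A|) N => // n IHn A leAn N hallA.
have [->|[a aA]] := set_0Vmem A.
  by exists (fun=> y0); split=> [x|x ? ]; rewrite inE.
(* If [X] is tight, it is matched into its neighbourhood [NX] and the rest of [A] outside [NX];
   tightness passes Hall's condition to the rest. *)
have [/existsP[X /and3P[pXA X0 leX]]|] := boolP [exists X : {set S},
    [&& X \proper A, X != set0 & #|\bigcup_(x in X) N x| <= #|X|]].
  have sXA := proper_sub pXA; set NX := \bigcup_(x in X) N x in leX.
  have [||h1 [h1N h1I]] := IHn X _ N.
  - by have := proper_card pXA; lia.
  - by move=> Y sYX; apply: hallA; apply: subset_trans sXA.
  have [||h2 [h2N h2I]] := IHn (A :\: X) _ (fun x => N x :\: NX).
  - rewrite cardsDS //; move: X0; rewrite -card_gt0.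
    by have := proper_card pXA; lia.
  - move=> Y; rewrite subsetD => /andP[sYA dYX].
    have := hallA (Y :|: X); rewrite subUset sYA sXA => /(_ isT).
    have -> : \bigcup_(x in Y :|: X) N x = (\bigcup_(x in Y) (N x :\: NX)) :|: NX.
      apply/setP => z; rewrite inE; apply/bigcupP/orP => [[x]|].
        rewrite inE => /orP[xY|xX] zN; last by right; apply/bigcupP; exists x.
        case: (boolP (z \in NX)) => zNX; [by right|left].
        by apply/bigcupP; exists x; rewrite // inE zNX.
      case=> /bigcupP[x xY]; last by exists x; rewrite // inE xY orbT.
      by rewrite inE => /andP[_ zN]; exists x; rewrite // inE xY.
    rewrite !cardsU disjoint_setI0 // cards0; lia.
  exists (fun x => if x \in X then h1 x else h2 x); split=> [x xA|x y xA yA].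
    case: ifPn => xX; first exact: h1N.
    by have := h2N x; rewrite !inE xX xA => /(_ isT)/andP[].
  have cross u v : u \in X -> v \in A -> v \notin X -> h1 u <> h2 v.
    move=> uX vA vX huv; have := h2N v; rewrite !inE vX vA => /(_ isT)/andP[/negP + _].
    by apply; rewrite -huv; apply/bigcupP; exists u => //; apply: h1N.
  case: ifPn => xX; case: ifPn => yX.
  - exact: h1I.
  - by move/cross; case.
  - by move/esym/cross; case.
  - by apply: h2I; rewrite inE ?xX ?yX.
(* Without tight subsets any neighbour [b] of [a] may be used up: every nonempty proper subset has a
   neighbour to spare. *)
move/existsPn => strict.
have /card_gt0P[b bNa] : 0 < #|N a|.
  have := hallA [set a]; rewrite sub1set aA big_set1 cards1; exact.
have [||h [hN hI]] := IHn (A :\ a) _ (fun x => N x :\ b).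
- by move: leAn; rewrite (cardsD1 a) aA; lia.
- move=> Y sYA; have [->|Y0] := eqVneq Y set0; first by rewrite cards0.
  have pYA : Y \proper A.
    by apply: sub_proper_trans sYA _; rewrite properD1.
  have := strict Y; rewrite pYA Y0 /= -ltnNge.
  have -> : \bigcup_(x in Y) (N x :\ b) = (\bigcup_(x in Y) N x) :\ b.
    apply/setP => z; rewrite !inE; apply/bigcupP/andP => [[x xY]|[zb /bigcupP[x xY zN]]].
      by rewrite !inE => /andP[-> zN]; split=> //; apply/bigcupP; exists x.
    by exists x; rewrite // !inE zb.
  by have := cardsD1 b (\bigcup_(x in Y) N x); case: (b \in _); lia.
exists (fun x => if x == a then b else h x); split=> [x xA|x y xA yA].
  case: eqP => [->//|/eqP xa].
  by have := hN x; rewrite !inE xa xA => /(_ isT)/andP[].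
have hb u : u \in A -> u != a -> h u <> b.
  by move=> uA ua hub; have := hN u; rewrite !inE ua uA hub eqxx => /(_ isT).
case: eqP => [->|/eqP xa]; case: eqP => [->|/eqP ya] //.
- by move/esym/hb; case.
- by move/hb; case.
- by apply: hI; rewrite !inE ?xa ?ya.
Qed.

(** Isolated vertices are exempt, because edge classes and quotient graphs live on vertex types in
    which many vertices meet no edge. *)
Definition quasiregular (T : finType) (e : rel T) (m : nat) : Prop :=
  forall u v, e u v -> deg e u = m.

Definition two_coloured (T : finType) (e : rel T) (c : T -> bool) : Prop :=
  forall u v, e u v -> c v = ~~ c u.

Section BipartiteMatching.

Variables (T : finType) (e : rel T) (m : nat).
Hypotheses (sym : symmetric e) (reg : quasiregular e m) (m_gt0 : 0 < m).

Let side (c : T -> bool) := [set u | c u && (deg e u == m)].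

Lemma quasiregular_deg_le u : deg e u <= m.
Proof.
by rewrite /deg; have [->|[v]] := set_0Vmem [set v | e u v]; rewrite ?cards0 // inE => /reg <-.
Qed.

(** Double counting: [m * #|X|] edges leave [X], and each vertex of its neighbourhood receives at
    most [m] of them. *)
Lemma quasiregular_hall (X : {set T}) : (forall u, u \in X -> deg e u = m) ->
  #|X| <= #|\bigcup_(u in X) [set v | e u v]|.
Proof.
move=> degX; rewrite -(leq_pmul2r m_gt0) -!sum_nat_const.
rewrite -(eq_bigr _ degX).
apply: (@leq_trans (\sum_(v in \bigcup_(u in X) [set v | e u v]) deg e v)); last first.
  by apply: leq_sum => v _; apply: quasiregular_deg_le.
under eq_bigr do rewrite deg_sum; under [leqRHS]eq_bigr do rewrite deg_sum.
rewrite exchange_big /= [leqRHS]big_mkcond /=; apply: leq_sum => v _.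
case: ifPn => [_|/bigcupP nv].
  by rewrite big_mkcond /=; apply: leq_sum => u _; rewrite sym; case: (u \in X).
rewrite big1 // => u uX; case: (boolP (e u v)) => // euv; case: nv.
by exists u; rewrite ?inE.
Qed.

Lemma quasiregular_bipartite_matching (c : T -> bool) : two_coloured e c ->
  exists M : rel T, [/\ symmetric M, subrel M e & forall u v, e u v -> deg M u = 1].
Proof.
move=> col.
have degS c' u : u \in side c' -> deg e u = m by rewrite inE => /andP[_ /eqP].
have nbS c' : two_coloured e c' ->
    \bigcup_(u in side c') [set v | e u v] \subset side (fun u => ~~ c' u).
  move=> col'; apply/subsetP => v /bigcupP[u]; rewrite !inE => /andP[c'u _] euv.
  by rewrite (col' _ _ euv) negbK c'u (reg (_ : e v u)) ?eqxx // sym.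
have colN : two_coloured e (fun u => ~~ c u) by move=> u v /col ->.
pose A := side c; pose B := side (fun u => ~~ c u).
(* Hall's inequality applied from the other side forces the injection from [A] into [B], found next,
   to be onto. *)
have leBA : #|B| <= #|A|.
  apply: leq_trans (quasiregular_hall (degS _)) _.
  apply: leq_trans (subset_leq_card (nbS _ colN)) _.
  by apply: subset_leq_card; apply/subsetP => u; rewrite !inE negbK.
have [x0 _|T0] := pickP T; last first.
  by exists e; split=> // u; have := T0 u.
have [|h [hA hI]] := @hall_marriage _ _ A (fun u => [set v | e u v]) x0.
  by move=> X sXA; apply: quasiregular_hall => u uX; apply: (degS c); apply: (subsetP sXA).
have eh u : u \in A -> e u (h u) by move/hA; rewrite inE.
have hAB : h @: A = B.
  apply/eqP; rewrite eqEcard card_in_imset // leBA andbT.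
  apply/subsetP => _ /imsetP[u uA ->]; apply: (subsetP (nbS _ col)).
  by apply/bigcupP; exists u; rewrite ?hA.
have AB u : u \in A -> u \in B -> False by rewrite !inE => /andP[->].
have hB u : u \in A -> h u \in B by move=> uA; rewrite -hAB imset_f.
pose M : rel T := fun u v => ((u \in A) && (v == h u)) || ((v \in A) && (u == h v)).
exists M; split.
- by move=> u v; rewrite /M orbC.
- by move=> u v /orP[]/andP[zA /eqP ->]; [|rewrite sym]; apply: eh.
- move=> u v euv; apply/eqP/cards1P.
  have [uA|uNA] := boolP (u \in A).
    exists (h u); apply/setP => w; rewrite !inE /M uA /=.
    case: eqP => //= _; apply/negP => /andP[wA /eqP uh].
    by apply: (AB u uA); rewrite uh hB.
  have : u \in B by move: uNA; rewrite !inE (reg euv) eqxx !andbT.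
  rewrite -hAB => /imsetP[a aA uE]; exists a; apply/setP => w.
  rewrite !inE /M (negPf uNA) /=; apply/andP/eqP => [[wA /eqP uw]|->].
    by apply: hI; rewrite // -uw.
  by rewrite aA uE.
Qed.

End BipartiteMatching.

(** * Flows on regular bipartite graphs *)

Lemma has_skew_flow_bipartite (T : finType) (e : rel T) (m : nat) (c : T -> bool) :
  symmetric e -> quasiregular e m -> 1 < m -> two_coloured e c -> has_skew_flow e.
Proof.
move=> sym reg m_gt1 col.
have irr : irreflexive e.
  by move=> u; apply/negP => euu; have := col _ _ euu; case: (c u).
have dege u : deg e u = 0 \/ exists v, e u v.
  have [d0|[v]] := set_0Vmem [set v | e u v]; first by left; rewrite /deg d0 cards0.
  by rewrite inE; right; exists v.
have [od|ev] := boolP (odd m); last first.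
  by apply: has_skew_flow_even => // u; case: (dege u) => [->|[v /reg ->]].
(* Degrees are prescribed wherever [e] has an edge, so each matching taken from a smaller graph
   still covers all nonisolated vertices of [e]. *)
have step (e1 : rel T) (m1 : nat) : symmetric e1 -> subrel e1 e ->
    (forall u v, e u v -> deg e1 u = m1) -> 0 < m1 ->
    exists M : rel T, [/\ symmetric M, subrel M e1 & forall u v, e u v -> deg M u = 1].
  move=> sym1 sub1 reg1 m1_gt0.
  have [||M [symM subM degM]] := @quasiregular_bipartite_matching T e1 m1 sym1 _ m1_gt0 c.
  - by move=> u v /sub1; apply: reg1.
  - by move=> u v /sub1; apply: col.
  exists M; split=> // u v /reg1 d1.
  have /card_gt0P[w] : 0 < deg e1 u by rewrite d1.
  by rewrite inE; apply: degM.
have [|||M1 [sym1 sub1 deg1]] := step e m sym; [by []|by []|lia|].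
pose e1 := [rel x y | e x y && ~~ M1 x y].
have syme1 : symmetric e1 by move=> x y /=; rewrite sym sym1.
have [|||M2 [sym2 sub2 deg2]] := step e1 m.-1 syme1.
- by move=> x y /andP[].
- by move=> u v euv; rewrite deg_diff // (deg1 _ _ euv) (reg _ _ euv); lia.
- lia.
pose e2 := [rel x y | e1 x y && ~~ M2 x y].
have syme2 : symmetric e2 by move=> x y /=; rewrite sym sym1 sym2.
have [|||M3 [sym3 sub3 deg3]] := step e2 m.-2 syme2.
- by move=> x y /andP[/andP[]].
- move=> u v euv; rewrite deg_diff // (deg2 _ _ euv).
  by rewrite deg_diff // (deg1 _ _ euv) (reg _ _ euv); lia.
- lia.
have sub2e : subrel M2 e by move=> x y /sub2/andP[].
have sub3e : subrel M3 e by move=> x y /sub3/andP[/andP[]].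
pose M : rel T := [rel x y | [|| M1 x y, M2 x y | M3 x y]].
have M12 x y : M1 x y -> M2 x y = false.
  by move=> h1; apply/negP => /sub2/andP[_]; rewrite h1.
have M13 x y : M1 x y -> M3 x y = false.
  by move=> h1; apply/negP => /sub3/andP[/andP[_]]; rewrite h1.
have M23 x y : M2 x y -> M3 x y = false.
  by move=> h1; apply/negP => /sub3/andP[_]; rewrite h1.
have subM : subrel M e by move=> x y /or3P[/sub1|/sub2e|/sub3e].
have symM : symmetric M by move=> x y; rewrite /M /= sym1 sym2 sym3.
have degM u v : e u v -> deg M u = 3.
  move=> euv; suff -> : deg M u = deg M1 u + deg M2 u + deg M3 u.
    by rewrite (deg1 _ _ euv) (deg2 _ _ euv) (deg3 _ _ euv).
  rewrite !deg_sum -!big_split /=; apply: eq_bigr => w _; rewrite /M /=.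
  have := @M12 u w; have := @M13 u w; have := @M23 u w.
  case: (M1 u w) => [_ /(_ isT) -> /(_ isT) ->|] //.
  by case: (M2 u w) => [/(_ isT) ->|] //; case: (M3 u w).
apply: (has_skew_flow_split symM subM); last first.
  apply: has_skew_flow_even => [x y|x|u] /=; first by rewrite sym symM.
    by rewrite irr.
  rewrite deg_diff //; case: (dege u) => [->|[v euv]] //.
  rewrite (degM _ _ euv) (reg _ _ euv); lia.
(* The weights -2, 1, 1 sum to zero at each vertex; the sign of the colour class makes them
   antisymmetric. *)
pose sg u : int := (if c u then 1 else -1)%R.
pose f u v : int := (sg u * ((M2 u v)%:R + (M3 u v)%:R - 2 * (M1 u v)%:R))%R.
(* Colours are known to differ only along edges, so antisymmetry off [M] has to come from the
   vanishing of [f]. *)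
have cases u v : M u v || (f u v == 0%R).
  rewrite /f /M /=; case: (M1 u v); case: (M2 u v); case: (M3 u v) => //=.
  by rewrite /sg; case: (c u).
exists f; split=> [u v|u v|u v|u].
- case/orP: (cases u v) => [Muv|f0].
    by rewrite /f sym1 sym2 sym3 /sg (col _ _ (subM _ _ Muv)); case: (c u) => /=; ring.
  case/orP: (cases v u) => [Mvu|/eqP ->]; last by rewrite (eqP f0) oppr0.
  by rewrite /f sym1 sym2 sym3 /sg (col _ _ (subM _ _ Mvu)); case: (c v) => /=; ring.
- rewrite /f /sg /M /=; have := @M12 u v; have := @M13 u v; have := @M23 u v.
  case: (M1 u v) => [_ /(_ isT) -> /(_ isT) ->|]; first by case: (c u).
  by case: (M2 u v) => [/(_ isT) ->|]; [|case: (M3 u v)]; case: (c u).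
- rewrite /f /sg /M /=; have := @M12 u v; have := @M13 u v; have := @M23 u v.
  case: (M1 u v) => [_ /(_ isT) -> /(_ isT) ->|]; first by case: (c u).
  by case: (M2 u v) => [/(_ isT) ->|]; [|case: (M3 u v)]; case: (c u).
- rewrite /f -mulr_sumr !big_split /= sumrN -mulr_sumr !sum_adj_deg.
  case: (dege u) => [d0|[v euv]].
    have z (r : rel T) : subrel r e -> deg r u = 0.
      move=> sr; apply/eqP; rewrite -leqn0 -d0; apply: subset_leq_card.
      by apply/subsetP => w; rewrite !inE; apply: sr.
    by rewrite !z // mulr0.
  by rewrite (deg1 _ _ euv) (deg2 _ _ euv) (deg3 _ _ euv) mulr0.
Qed.

Lemma has_skew_flow0 (T : finType) (e : rel T) :
  (forall u v, ~~ e u v) -> has_skew_flow e.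
Proof.
move=> e0; exists (fun _ _ => 0%R); split=> // [u v|u]; last by rewrite big1.
by rewrite (negPf (e0 u v)).
Qed.

Definition invariant_under (T : finType) (e : rel T) (G : {set {perm T}}) : Prop :=
  forall p, p \in G -> forall u v, e (p u) (p v) = e u v.

Definition transitive_on_arcs (T : finType) (e : rel T) (G : {set {perm T}}) : Prop :=
  forall u v u' v', e u v -> e u' v' -> exists2 p, p \in G & p u = u' /\ p v = v'.

(** * Graphs on an orbit of an elementary abelian 2-group *)

Section ElementaryAbelian2.

Variables (T : finType) (e : rel T) (N : {group {perm T}}) (k : nat) (x0 : T).
Hypotheses (sym : symmetric e) (irr : irreflexive e) (reg : quasiregular e k).
Hypotheses (k_odd : odd k) (k_gt4 : 4 < k).
Hypotheses (cNN : abelian N) (N2 : forall p, p \in N -> (p * p = 1)%g).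
Hypothesis inv : invariant_under e N.
Hypothesis orb : forall u v, e u v -> exists2 p, p \in N & u = p x0.

(* Three neighbours a x0, b x0, c x0 with c x0 <> ab x0 span cubes, which are
   bipartite; deleting them leaves an even valency. *)
Lemma has_skew_flow_abelem2 : has_skew_flow e.
Proof.
have k3_even : ~~ odd (k - 3) by rewrite oddB ?k_odd // (leq_trans _ k_gt4).
have comm p q u : p \in N -> q \in N -> p (q u) = q (p u).
  by move=> pN qN; rewrite -!permM (centsP cNN p pN q qN).
have sq p u : p \in N -> p (p u) = u by move=> pN; rewrite -permM N2 // perm1.
have [d0|[y1]] := set_0Vmem [set v | e x0 v].
  apply: has_skew_flow0 => u v; apply/negP => euv; have [p pN up] := orb euv.
  suff : p^-1%g v \in set0 by rewrite inE.
  by rewrite -d0 inE -(inv pN) -up permKV.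
rewrite inE => e1; have degx := reg e1.
have nbr v : e x0 v -> exists2 a, a \in N & v = a x0.
  by rewrite sym => /orb.
have [a aN y1a] := nbr _ e1; subst y1.
have pick_nbr (A : {set T}) : #|A| < k -> exists2 v, e x0 v & v \notin A.
  move=> ltA; have : 0 < #|[set v | e x0 v] :\: A|.
    rewrite cardsD subn_gt0 -/(deg e x0) degx; apply: leq_ltn_trans ltA.
    by rewrite subset_leq_card // subsetIr.
  by case/card_gt0P => v; rewrite !inE => /andP[vA ev]; exists v.
have [|y2 e2 ny2] := pick_nbr [set a x0]; first by rewrite cards1; lia.
have [b bN y2b] := nbr _ e2; subst y2.
(* Avoiding [a (b x0)] as well makes [a], [b], [c] independent on the orbit; only three points are
   excluded, fewer than [k]. *)
have [|y3 e3 ny3] := pick_nbr [set a x0; b x0; a (b x0)].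
  apply: leq_ltn_trans (_ : 3 < k); last lia.
  by rewrite -setUA cardsU1 cards2; case: (_ \notin _); case: (_ != _).
have [c cN y3c] := nbr _ e3; subst y3.
have ba : b x0 != a x0 by move: ny2; rewrite inE.
have [ca cb cab] : [/\ c x0 != a x0, c x0 != b x0 & c x0 != a (b x0)].
  by move: ny3; rewrite !inE !negb_or => /andP[/andP[]].
pose orbit u := exists2 p, p \in N & u = p x0.
(* Since [N] is abelian, comparisons made at [x0] carry over to every point of its orbit. *)
have ne u p q : orbit u -> p \in N -> q \in N -> p x0 != q x0 -> p u != q u.
  by case=> r rN -> pN qN; rewrite (comm p) // (comm q) // (inj_eq perm_inj).
have eM u p : orbit u -> p \in N -> e x0 (p x0) -> e u (p u).
  by case=> r rN -> pN; rewrite (comm p) // (inv rN).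
pose O := [set u | [exists p in N, u == p x0]].
have OP u : reflect (orbit u) (u \in O).
  rewrite inE; apply: (iffP existsP) => [[p /andP[pN /eqP ->]]|[p pN ->]]; first by exists p.
  by exists p; rewrite pN eqxx.
clearbody O.
have Op u p : p \in N -> u \in O -> p u \in O.
  move=> pN /OP[r rN ->]; apply/OP; exists (r * p)%g; first by rewrite groupM.
  by rewrite permM.
pose M : rel T := fun u v => (u \in O) && (v \in [set a u; b u; c u]).
have symM : symmetric M.
  move=> u v; suff sM x y : M x y -> M y x by apply/idP/idP; apply: sM.
  rewrite /M !inE => /andP[xO /orP[/orP[]|]/eqP ->];
  by rewrite Op // sq // eqxx ?orbT.
have subM : subrel M e.
  move=> u v /andP[/OP uO]; rewrite !inE => /orP[/orP[]|]/eqP ->; exact: eM.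
have degM u : u \in O -> deg M u = 3.
  move=> uO; have /OP uo := uO.
  rewrite /deg (_ : [set _ | _] = [set a u; b u; c u]); last first.
    by apply/setP => v; rewrite !inE /M uO !inE.
  rewrite setUC cardsU1 cards2 !inE negb_or (ne u c a) // (ne u c b) //.
  by rewrite eq_sym (ne u b a).
(* The orbit of [u] under products of an even number of [a], [b], [c]: one half of the cube through
   [u]. Each of the three generators exchanges the two halves. *)
pose K u := [set u; a (b u); a (c u); b (c u)].
(* Equal halves would give a loop at [u], or [c u = a (b u)], which the choice of the third
   neighbour excludes. *)
have nK u : u \in O -> K u != K (a u).
  move=> /OP uo; apply/eqP => EK; have : a u \in K u by rewrite EK !inE eqxx.
  rewrite !inE => /orP[/orP[/orP[]|]|].
  - by apply/negP; have := eM u a uo aN e1; apply: contraTN => /eqP ->; rewrite irr.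
  - by rewrite (inj_eq perm_inj) eq_sym; apply/negP; have := eM u b uo bN e2;
       apply: contraTN => /eqP ->; rewrite irr.
  - by rewrite (inj_eq perm_inj) eq_sym; apply/negP; have := eM u c uo cN e3;
       apply: contraTN => /eqP ->; rewrite irr.
  - move=> /eqP /(congr1 b); rewrite sq // -(comm a) // => abc.
    have abN : (b * a)%g \in N by rewrite groupM.
    by have := ne u c (b * a)%g uo cN abN; rewrite !permM abc eqxx => /(_ cab).
have Kab u : K (b u) = K (a u).
  apply/setP => v; rewrite !inE (comm b a u) // (comm c b u) // (comm c a u) //.
  rewrite (comm b a (c u)) // !(sq a) // !(sq b) // -!orbA.
  by do 4 case: (v == _).
have Kac u : K (c u) = K (a u).
  apply/setP => v; rewrite !inE (comm b a u) // (comm c a u) // (comm b a (c u)) //.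
  rewrite !(sq a) // !(sq c) // -!orbA.
  by do 4 case: (v == _).
have Kabu u : K (a (b u)) = K u by rewrite -(comm b) // Kab !sq.
have Kacu u : K (a (c u)) = K u by rewrite -(comm c) // Kac !sq.
pose col u := enum_rank (K u) < enum_rank (K (a u)).
apply: (has_skew_flow_split symM subM).
  apply: (@has_skew_flow_bipartite _ _ 3 col) => //.
    by move=> u v /andP[/degM].
  move=> u v /andP[uO]; rewrite /col !inE => /orP[/orP[]|]/eqP ->.
  - by rewrite sq // enum_rank_ltN // eq_sym nK.
  - by rewrite Kabu Kab enum_rank_ltN // eq_sym nK.
  - by rewrite Kacu Kac enum_rank_ltN // eq_sym nK.
apply: has_skew_flow_even => [u v|u|u] /=; first by rewrite sym symM.
  by rewrite irr.
rewrite deg_diff //; case: (boolP (u \in O)) => [uO|uO].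
  rewrite degM // (_ : deg e u = k) //.
  by have /OP uo := uO; apply: reg (eM u a uo aN e1).
suff -> : deg e u = 0 by [].
apply/eqP; rewrite cards_eq0; apply/set0Pn => -[v]; rewrite inE => /orb/OP.
by rewrite (negPf uO).
Qed.

End ElementaryAbelian2.

(** * Restriction to nonisolated vertices *)

Definition nonisolated (T : finType) (e : rel T) := [set u | 0 < deg e u].

Lemma nonisolatedP (T : finType) (e : rel T) u :
  reflect (exists v, e u v) (u \in nonisolated e).
Proof.
rewrite inE; apply: (iffP idP) => [/card_gt0P[v]|[v /deg_gt0 //]].
by rewrite inE; exists v.
Qed.

(* Isolated vertices are carried along, so the group has to be cut down to one
   that is faithful on the remaining vertices. *)
Lemma restrict_to_nonisolated (T : finType) (e : rel T) (G : {group {perm T}}) :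
  symmetric e -> solvable G -> invariant_under e G -> transitive_on_arcs e G ->
  exists H : {group {perm T}}, [/\ solvable H, invariant_under e H,
    transitive_on_arcs e H & forall p, p \in H -> perm_on (nonisolated e) p].
Proof.
move=> sym solG inv tr; set S := nonisolated e.
have nS p : p \in G -> p \in 'N(S | 'P)%g.
  move=> pG; apply/astabsP => u /=; rewrite apermE.
  apply/nonisolatedP/nonisolatedP => -[v].
    by rewrite -[v](permKV p) inv //; exists (p^-1 v)%g.
  by exists (p v); rewrite inv.
have rE p u : p \in G -> u \in S -> restr_perm S p u = p u.
  by move=> pG uS; rewrite restr_permE // nS.
exists (restr_perm S @* G)%G; split=> /=.
- exact: morphim_sol.
- move=> _ /morphimP[p _ pG ->] u v.
  have outS x y : x \notin S -> e x y = false.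
    by move=> xS; apply/negP => exy; case/nonisolatedP: xS; exists y.
  have out x : x \notin S -> restr_perm S p x = x by apply: out_perm; apply: restr_perm_on.
  have [uS|uS] := boolP (u \in S); last by rewrite out // !outS.
  have [vS|vS] := boolP (v \in S); first by rewrite !rE // inv.
  by rewrite (out v) // ![e _ v]sym !outS.
- move=> u v u' v' euv euv'; have [p pG [pu pv]] := tr _ _ _ _ euv euv'.
  exists (restr_perm S p); first by apply: mem_morphim; rewrite ?nS.
  have uS : u \in S by apply/nonisolatedP; exists v.
  have vS : v \in S by apply/nonisolatedP; exists u; rewrite sym.
  by rewrite !rE.
- by move=> _ /morphimP[p _ pG ->]; apply: restr_perm_on.
Qed.

(** * Orbits of a normal subgroup and the quotient graph *)

Section NormalQuotient.

Variables (T : finType) (e : rel T) (G N : {group {perm T}}) (k : nat).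
Hypotheses (sym : symmetric e) (irr : irreflexive e) (reg : quasiregular e k).
Hypotheses (inv : invariant_under e G) (tr : transitive_on_arcs e G).
Hypotheses (sNG : N \subset G) (nNG : G \subset 'N(N)%g).

Let q u := orbit 'P N u.

Lemma block_act p u : p \in N -> q (p u) = q u.
Proof. by move=> pN; apply/orbit_eqP/orbitP; exists p. Qed.

Lemma blockP u v : reflect (exists2 p, p \in N & p u = v) (q v == q u).
Proof.
apply: (iffP eqP) => [/orbit_eqP/orbitP[p pN <-]|[p pN <-]]; first by exists p.
exact: block_act.
Qed.

Lemma block_image g u : g \in G -> q (g u) = [set g x | x in q u].
Proof.
move=> gG; have gN := subsetP nNG g gG; apply/setP => w; apply/orbitP/imsetP.
  case=> p pN; rewrite /= apermE => <-; exists ((p ^ g^-1)%g u).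
    by apply/orbitP; exists (p ^ g^-1)%g; rewrite ?memJ_norm ?groupV.
  by rewrite conjgE invgK !permM permKV.
case=> _ /orbitP[p pN <-] ->; exists (p ^ g)%g; first by rewrite memJ_norm.
by rewrite /= !apermE conjgE !permM permK.
Qed.

Lemma eq_block_image g u v : g \in G -> (q (g u) == q (g v)) = (q u == q v).
Proof. by move=> gG; rewrite !block_image // (inj_eq (imset_inj perm_inj)). Qed.

(** An element of [G] carrying one arc to the other permutes the blocks, as [N] is normalised by
    [G]. *)
Lemma nbrs_in_block_const u v u' v' : e u v -> e u' v' ->
  #|[set w | e u w && (q w == q v)]| = #|[set w | e u' w && (q w == q v')]|.
Proof.
move=> euv euv'; have [g gG [<- <-]] := tr euv euv'.
rewrite -[RHS](card_preimset _ (@perm_inj _ g)); apply: eq_card => w.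
by rewrite !inE inv // eq_block_image.
Qed.

(** The unordered pair of blocks labelling an edge is here a singleton, so each class is a graph of
    valency [k] on a single orbit. *)
Lemma inner_edges_skew_flow (p : nat) : prime p -> p.-abelem%g N -> odd k -> 4 < k ->
  (forall u v, e u v -> q u = q v) -> has_skew_flow e.
Proof.
move=> p_pr abN k_odd k_gt4 inner.
have [cNN Np] := (abelemP p_pr abN).
have invN : invariant_under e N by move=> g gN; apply: inv; apply: (subsetP sNG).
apply: (@has_skew_flow_classes _ _ _ (fun u v => [set q u; q v])) => [u v|i].
  by rewrite setUC.
set ei := (X in has_skew_flow X).
have [/existsP[x /existsP[y /andP[exy /eqP iE]]]|none] :=
    boolP [exists x, exists y, e x y && ([set q x; q y] == i)]; last first.
  apply: has_skew_flow0 => u v; move: none; apply: contra => euv.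
  by apply/existsP; exists u; apply/existsP; exists v.
have eiE u v : ei u v = e u v && (q u == q x).
  rewrite /ei /=; case: (boolP (e u v)) => //= euv.
  by rewrite -iE -(inner _ _ euv) -(inner _ _ exy) !setUid (inj_eq set1_inj).
have syme : symmetric ei.
  move=> u v; rewrite !eiE sym; case: (boolP (e v u)) => //= evu.
  by rewrite (inner _ _ evu).
have irre : irreflexive ei by move=> u; rewrite eiE irr.
have dege u : deg ei u = if q u == q x then k else 0.
  case: ifPn => qux.
    have /blockP[g gN gx] := qux; have euy : e u (g y) by rewrite -gx invN.
    rewrite -(reg euy); apply: eq_card => w; rewrite !inE eiE.
    by rewrite qux andbT.
  by apply/eqP; rewrite cards_eq0; apply/set0Pn => -[w]; rewrite inE eiE (negPf qux) andbF.
have rege : quasiregular ei k.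
  by move=> u v; rewrite dege eiE => /andP[_ ->].
(* For odd [p] an orbit would have odd size, being of [p]-power size, and odd valency [k], against
   the handshake lemma. *)
case: (boolP (odd p)) => [p_odd|p_even].
  have := handshake syme irre; under eq_bigr do rewrite dege.
  rewrite -big_mkcond sum_nat_const oddM k_odd andbT => /negP[].
  have -> : #|[pred u | q u == q x]| = #|q x|.
    by apply: eq_card => u; rewrite inE; apply/eqP/idP => /orbit_eqP.
  apply: dvdn_odd (dvdn_orbit 'P N x) _.
  have [n ->] := p_natP (abelem_pgroup abN); by rewrite oddX p_odd orbT.
have {p_pr p_even}p2 : p = 2 by case: (even_prime p_pr) => // p_odd; rewrite p_odd in p_even.
apply: (@has_skew_flow_abelem2 _ _ N k x) => //.
- by move=> g gN; have := Np g gN; rewrite p2 expgS expg1.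
- by move=> g gN u v; rewrite !eiE invN // block_act.
- by move=> u v; rewrite eiE => /andP[_ /blockP[g gN <-]]; exists g.
Qed.

(** The edges between two fixed blocks form an [m]-valent graph, two-coloured by membership in one
    of the blocks. *)
Lemma multicover_skew_flow m : 1 < m -> (forall u v, e u v -> q u != q v) ->
  (forall u v, e u v -> #|[set w | e u w && (q w == q v)]| = m) -> has_skew_flow e.
Proof.
move=> m_gt1 outer degm.
apply: (@has_skew_flow_classes _ _ _ (fun u v => [set q u; q v])) => [u v|i].
  by rewrite setUC.
set ei := (X in has_skew_flow X).
have [/existsP[x /existsP[y /andP[exy /eqP iE]]]|none] :=
    boolP [exists x, exists y, e x y && ([set q x; q y] == i)]; last first.
  apply: has_skew_flow0 => u v; move: none; apply: contra => euv.
  by apply/existsP; exists u; apply/existsP; exists v.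
have qxy := outer _ _ exy.
apply: (@has_skew_flow_bipartite _ _ m (fun u => q u == q x)) => //.
- by move=> u v; rewrite /ei /= sym setUC.
- move=> u v /andP[euv /eqP uvi]; rewrite -(degm _ _ euv); apply: eq_card => w.
  rewrite !inE /ei /=; case: (boolP (e u w)) => //= euw; rewrite -uvi.
  apply/eqP/eqP => [/setP/(_ (q w))|->] //.
  by rewrite !inE eqxx orbT eq_sym (negPf (outer _ _ euw)) => /esym/eqP.
- move=> u v /andP[euv /eqP uvi]; have := outer _ _ euv.
  have : q x \in [set q u; q v] by rewrite uvi -iE !inE eqxx.
  rewrite !inE ![q x == _]eq_sym; case: (eqVneq (q u) (q x)) => [->|_ /= ->] //.
  by rewrite eq_sym => _ /negPf ->.
Qed.

Definition block_graph : rel {set T} :=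
  fun B C => [exists u, exists v, [&& e u v, B == q u & C == q v]].

Lemma block_graphP B C :
  reflect (exists u v, [/\ e u v, B = q u & C = q v]) (block_graph B C).
Proof.
apply: (iffP existsP) => [[u /existsP[v /and3P[euv /eqP -> /eqP ->]]]|[u [v [euv -> ->]]]].
  by exists u, v.
by exists u; apply/existsP; exists v; rewrite euv !eqxx.
Qed.

(** As a homomorphic image of [G], this group inherits solvability. *)
Definition block_group := (actperm ('P^*)%act @* G)%G.

Lemma block_actE g u : g \in G -> actperm ('P^*)%act g (q u) = q (g u).
Proof. by move=> gG; rewrite actpermE block_image // /= setactE. Qed.

Lemma block_graph_sym : symmetric block_graph.
Proof.
by move=> B C; apply/block_graphP/block_graphP => -[u [v [euv -> ->]]]; exists v, u; rewrite sym.
Qed.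

Lemma block_graph_invariant : invariant_under block_graph block_group.
Proof.
move=> h /morphimP[g _ gG hg] B C.
have hq w : h (q w) = q (g w) by rewrite hg; exact: block_actE.
apply/block_graphP/block_graphP => -[u [v [euv EB EC]]].
  have gVG : (g^-1 \in G)%g by rewrite groupV.
  have hE w : h (q (g^-1 w)%g) = q w by rewrite hq permKV.
  exists (g^-1 u)%g, (g^-1 v)%g; rewrite (inv gVG); split=> //.
    by apply: (@perm_inj _ h); rewrite hE.
  by apply: (@perm_inj _ h); rewrite hE.
by exists (g u), (g v); rewrite inv // EB EC !hq.
Qed.

Lemma block_graph_transitive : transitive_on_arcs block_graph block_group.
Proof.
move=> _ _ _ _ /block_graphP[u [v [euv -> ->]]] /block_graphP[u' [v' [euv' -> ->]]].
have [g gG [<- <-]] := tr euv euv'.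
exists (actperm ('P^*)%act g); last by rewrite !block_actE.
by apply: mem_morphim; rewrite // inE.
Qed.

(** A vertex [x] moved by [g] shares its block with [g x], which is also nonisolated; hence the
    nonisolated vertices other than [x] already represent every nonisolated block. *)
Lemma block_graph_nonisolated_lt g : g \in N -> g != 1%g ->
  perm_on (nonisolated e) g ->
  #|nonisolated block_graph| < #|nonisolated e|.
Proof.
move=> gN g1 gS.
have [x gx] : exists x, g x != x.
  by apply/existsP; apply: contraNT g1 => /existsPn gid; apply/eqP/permP => x;
     rewrite perm1; apply/eqP; rewrite -[_ == _]negbK gid.
have xS : x \in nonisolated e by apply: (subsetP gS); rewrite inE.
have gxS : g x \in nonisolated e by rewrite (perm_closed _ gS).
have sub : nonisolated block_graph \subset q @: (nonisolated e :\ x).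
  apply/subsetP => B /nonisolatedP[C /block_graphP[u [v [euv -> _]]]].
  have [ux|ux] := eqVneq u x.
    by rewrite ux -(block_act x gN) imset_f // !inE gx /=; rewrite inE in gxS.
  by rewrite imset_f // !inE ux /= (deg_gt0 euv).
apply: leq_ltn_trans (subset_leq_card sub) _.
apply: leq_ltn_trans (leq_imset_card _ _) _.
by rewrite [X in _ < X](cardsD1 x) xS.
Qed.

Section Cover.

Hypothesis outer : forall u v, e u v -> q u != q v.
Hypothesis cover : forall u v, e u v -> #|[set w | e u w && (q w == q v)]| = 1.

Lemma block_graph_irr : irreflexive block_graph.
Proof.
move=> B; apply/block_graphP => -[u [v [/outer euv -> E]]].
by rewrite E eqxx in euv.
Qed.

Lemma block_inj u : {in [set v | e u v] &, injective q}.
Proof.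
move=> v w; rewrite !inE => euv euw qvw.
have /eqP/cards1P[z zP] := cover euv.
have : v \in [set z] by rewrite -zP inE euv eqxx.
have : w \in [set z] by rewrite -zP inE euw qvw eqxx.
by rewrite !inE => /eqP -> /eqP ->.
Qed.

(** An arc starting anywhere in the block of [u] can be moved by [N] to start at [u] without
    changing its blocks. *)
Lemma block_nbrs u : [set C | block_graph (q u) C] = q @: [set v | e u v].
Proof.
apply/setP => C; rewrite inE; apply/block_graphP/imsetP => [[x [y [exy /eqP qux ->]]]|[v]].
  have /blockP[g gN gx] := qux.
  exists (g y); last by rewrite block_act.
  by rewrite inE -gx inv // (subsetP sNG).
by rewrite inE => euv ->; exists u, v.
Qed.

Lemma block_graph_quasiregular : quasiregular block_graph k.
Proof.
move=> _ C /block_graphP[u [v [euv -> _]]].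
by rewrite /deg block_nbrs (card_in_imset (@block_inj u)) -/(deg e u) (reg euv).
Qed.

(** The quotient map sends the neighbours of [u] bijectively onto those of [q u], so conservation at
    [q u] gives conservation of the pulled-back flow at [u]. *)
Lemma block_graph_skew_flow : has_skew_flow block_graph -> has_skew_flow e.
Proof.
case=> f [fN fe f2 f0].
exists (fun u v => if e u v then f (q u) (q v) else 0%R); split=> [u v|u v|u v|u].
- by rewrite sym; case: ifP => _; rewrite ?oppr0.
- case: (boolP (e u v)) => // euv.
  by rewrite fe; apply/block_graphP; exists u, v.
- by case: ifP.
- rewrite -big_mkcond /= -[RHS](f0 (q u)) [RHS](bigID (block_graph (q u))) /=.
  rewrite [X in (_ = _ + X)%R]big1 ?addr0; last by move=> C; rewrite -fe negbK => /eqP.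
  transitivity (\sum_(C in q @: [set v | e u v]) f (q u) C)%R.
    rewrite big_imset /=; last exact: block_inj.
    by apply: eq_bigl => v; rewrite inE.
  by rewrite -block_nbrs; apply: eq_bigl => C; rewrite inE.
Qed.

End Cover.

End NormalQuotient.

(** * Induction through normal quotients *)

(** The induction counts nonisolated vertices rather than [#|T|], because the quotient graph has the
    larger vertex type [{set T}]. *)
Lemma arc_transitive_skew_flow n (T : finType) (e : rel T) (G : {group {perm T}}) (k : nat) :
  #|nonisolated e| < n -> symmetric e -> irreflexive e -> quasiregular e k ->
  odd k -> 4 < k -> solvable G -> invariant_under e G -> transitive_on_arcs e G ->
  has_skew_flow e.
Proof.
elim: n T e G => // n IHn T e G0 lt_n sym irr reg k_odd k_gt4 solG0 inv0 tr0.
have [/existsP[x /existsP[y exy]]|none] := boolP [exists x, exists y, e x y]; last first.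
  apply: has_skew_flow0 => u v; move: none; apply: contra => euv.
  by apply/existsP; exists u; apply/existsP; exists v.
have [G [solG inv tr onS]] := restrict_to_nonisolated sym solG0 inv0 tr0.
(* Some element of [G] reverses the arc from [x] to [y], and the identity does not. *)
have ntG : G != 1%g :> {set _}.
  apply: contraTneq exy => G1; apply/negP => exy.
  have [|g] := tr _ _ _ _ exy (_ : e y x); first by rewrite sym.
  by rewrite G1 inE => /eqP -> [/esym]; rewrite perm1 => yx; rewrite yx irr in exy.
have [N minN sNG] := minnormal_exists ntG (normG G).
have [nNG ntN /is_abelemP[p p_pr abN]] := minnormal_solvable minN sNG solG.
pose q u := orbit 'P N u.
have block_const u v : e u v -> (q u == q v) = (q x == q y).
  move=> euv; have [g gG [<- <-]] := tr _ _ _ _ exy euv.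
  by rewrite (eq_block_image nNG).
have [qxy|qxy] := boolP (q x == q y).
  apply: (inner_edges_skew_flow sym irr reg inv sNG p_pr abN k_odd k_gt4) => u v euv.
  by apply/eqP; rewrite block_const.
have outer u v : e u v -> q u != q v by move=> euv; rewrite block_const.
pose m := #|[set w | e x w && (q w == q y)]|.
have degm u v : e u v -> #|[set w | e u w && (q w == q v)]| = m.
  by move=> euv; apply: nbrs_in_block_const inv tr nNG _ _ _ _ euv exy.
have m_gt0 : 0 < m by apply/card_gt0P; exists y; rewrite inE exy eqxx.
have [m_gt1|m_le1] := ltnP 1 m; first exact: (multicover_skew_flow sym m_gt1 outer degm).
have m1 : m = 1 by apply/eqP; rewrite eqn_leq m_le1.
rewrite m1 in degm.
apply: (block_graph_skew_flow sym inv sNG degm).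
(* [G] now fixes all isolated vertices, so a nontrivial [g] in [N] moves a nonisolated one and the
   quotient is strictly smaller. *)
have [g gN g1] : exists2 g, g \in N & g != 1%g by apply/trivgPn.
apply: (IHn _ _ (block_group G)) => //.
- rewrite -ltnS; apply: leq_trans lt_n.
  exact: (block_graph_nonisolated_lt gN g1 (onS _ (subsetP sNG _ gN))).
- exact: block_graph_sym.
- exact: block_graph_irr.
- exact: (block_graph_quasiregular reg inv sNG degm).
- exact: morphim_sol.
- exact: block_graph_invariant.
- exact: block_graph_transitive.
Qed.

Theorem mainTheorem1 (V : finType) (adj : rel V) (k : nat)
  (gT : finGroupType) (G : {group gT}) (to : action G V) :
  simple_graph adj ->
  regular_of_valency adj k -> 4 <= k ->
  solvable G ->
  acts_by_automorphisms to adj ->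
  arc_transitive to adj ->
  has_nz_flow adj 3.
Proof.
case=> sym irr reg k_ge4 solG inv [_ tr]; apply: has_nz_flow_skew.
have [k_odd|k_even] := boolP (odd k); last first.
  by apply: has_skew_flow_even => // u; rewrite /deg reg.
(* A possibly unfaithful action is replaced by its image in the permutations of [V]. *)
apply: (@arc_transitive_skew_flow _ _ _ (actperm to @* G)%G k (ltnSn _)) => //.
- by move=> u v _; exact: reg.
- by move: k_ge4 k_odd; rewrite leq_eqVlt => /orP[/eqP <-|].
- exact: morphim_sol.
- by move=> _ /morphimP[g _ gG ->] u v; rewrite !actpermE inv.
- move=> u v u' v' euv euv'; have [g gG [gu gv]] := tr _ _ _ _ euv euv'.
  by exists (actperm to g); rewrite ?actpermE ?mem_morphim.
Qed.
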